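(* Fix an integer $d\ge 2$. Then $M_k(d)=\Theta(k^{d})$ and $N_k(d)=\Theta(k^{d-1})$ as $k\to\infty$; that is, there are constants $0<c_d\le C_d$ depending only on $d$ such that for all $k\ge 1$, $c_dk^d\le M_k(d)\le C_dk^d$ and $c_dk^{d-1}\le N_k(d)\le C_dk^{d-1}$.
   Context: A set $P\subseteq\mathbb{R}^d$ is separated if $\|p_1-p_2\|\ge 1$ for all distinct $p_1,p_2\in P$. For $\varepsilon>0$, a separated set $P$ is an $\varepsilon$-nearly $k$-distance set (with distances $1\le t_1<\dots<t_k$) if $\|p_1-p_2\|\in\bigcup_{i=1}^k[t_i,t_i+\varepsilon]$ for all distinct $p_1,p_2\in P$. $M_k(d)$ is the largest $M$ such that for every $\varepsilon>0$ there is an $\varepsilon$-nearly $k$-distance set in $\mathbb{R}^d$ of cardinality $M$. Flatness: a $d$-plane is an affine subspace of dimension $d$. The angle between a vector $v$ and a plane $\Lambda$ is the infimum of the angles between $v$ and the vectors $w\in\Lambda-\Lambda$. A set of vectors $V$ is $(d,\alpha)$-flat with respect to a $d$-plane $\Lambda$ if the angle between every $v\in V$ and $\Lambda$ is at most $\alpha$. A set $P$ is $(p,d,\alpha)$-flat (for $p\in P$) with respect to a $d$-plane $\Lambda_p$ if $\{p-q:q\in P\}$ is $(d,\alpha)$-flat with respect to $\Lambda_p$; $P$ is $(d,\alpha)$-flat if for every $p\in P$ it is $(p,d,\alpha)$-flat with respect to some $d$-plane $\Lambda_p$. $N_k(d)$ (for $d\ge1$) is the largest $N$ such that for every $\varepsilon,\alpha>0$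 there exists a $(d-1,\alpha)$-flat $\varepsilon$-nearly $k$-distance set in $\mathbb{R}^{d}$ of cardinality $N$. *)

(* Defs.v *)
From HB Require Import structures.
From mathcomp Require Import all_boot all_order all_algebra.
From mathcomp Require Import all_classical all_reals all_analysis.
From mathcomp Require Import Rstruct Rstruct_topology.
Set Implicit Arguments. Unset Strict Implicit. Unset Printing Implicit Defensive.
Import Order.TTheory GRing.Theory Num.Theory.
Local Open Scope ring_scope.
Local Open Scope classical_set_scope.

Notation RR := Rdefinitions.R.

Definition vec (d : nat) := 'rV[RR]_d.

Definition dotv (d : nat) (u v : vec d) : RR := \sum_(i < d) u 0 i * v 0 i.
Definition normv (d : nat) (u : vec d) : RR := Num.sqrt (dotv u u).

(* A finite point set of cardinality M is given as a map 'I_M -> R^d;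
   separatedness forces injectivity, so the image has exactly M points. *)
Definition separated (d M : nat) (P : 'I_M -> vec d) : Prop :=
  forall a b : 'I_M, a != b -> 1 <= normv (P a - P b).

Definition eps_nearly_kdist (d k M : nat) (eps : RR) (P : 'I_M -> vec d) : Prop :=
  separated P /\
  exists t : 'I_k -> RR,
    (forall i, 1 <= t i) /\
    (forall i j : 'I_k, (i < j)%N -> t i < t j) /\
    (forall a b : 'I_M, a != b ->
       exists i : 'I_k, t i <= normv (P a - P b) <= t i + eps).

Definition is_plane (d m : nat) (L : set (vec d)) : Prop :=
  exists (a : vec d) (W : 'M[RR]_d),
    \rank W = m /\ L = [set a + w | w in [set w : vec d | (w <= W)%MS]].

Definition vangle (d : nat) (u v : vec d) : RR :=
  acos (dotv u v / (normv u * normv v)).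

Definition plane_angle (d : nat) (v : vec d) (L : set (vec d)) : RR :=
  inf [set vangle v w | w in [set w | (exists x y, L x /\ L y /\ w = x - y) /\ w != 0]].

Definition vecs_flat (d m : nat) (alpha : RR) (V : set (vec d)) (L : set (vec d)) : Prop :=
  forall v, V v -> plane_angle v L <= alpha.

Definition pt_flat (d M m : nat) (alpha : RR) (P : 'I_M -> vec d) (p : vec d)
  (L : set (vec d)) : Prop :=
  vecs_flat m alpha [set p - P b | b in [set b | P b != p]] L.

Definition flat (d M m : nat) (alpha : RR) (P : 'I_M -> vec d) : Prop :=
  forall a : 'I_M, exists L, is_plane m L /\ pt_flat m alpha P (P a) L.

(* M is admissible for M_k(d): for every eps > 0 there is an eps-nearly
   k-distance set in R^d of cardinality M. M_k(d) is the largest such M. *)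
Definition M_admissible (d k M : nat) : Prop :=
  forall eps : RR, 0 < eps -> exists P : 'I_M -> vec d, eps_nearly_kdist k eps P.

Definition N_admissible (d k N : nat) : Prop :=
  forall eps alpha : RR, 0 < eps -> 0 < alpha ->
    exists P : 'I_N -> vec d, eps_nearly_kdist k eps P /\ flat d.-1 alpha P.

(* Main.v *)
Require Import Defs.
From HB Require Import structures.
From mathcomp Require Import all_boot all_order all_algebra.
From mathcomp Require Import all_classical all_reals all_analysis.
From mathcomp Require Import Rstruct Rstruct_topology.
From mathcomp Require Import ring lra zify.
Set Implicit Arguments. Unset Strict Implicit. Unset Printing Implicit Defensive.
Import Order.TTheory GRing.Theory Num.Theory.
Local Open Scope ring_scope.

(* Upper bounds: by induction on m, an m-flat nearly k-distance set has O(k^m)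
   points, for a fixed small tolerance depending only on d and m.  Fix a point p
   and split the others into the k shells around p, and each shell of radius t
   into O(1) cells of diameter at most alpha t.  Differences of points q, q' of
   one cell are almost orthogonal to q - p, which itself lies near the plane at
   q, so each cell is (m-1)-flat.  M_k is the case m = d and N_k the case
   m = d - 1.

   Lower bounds: in a product of d progressions {0, ..., k/d} scaled by rapidly
   growing T_0 << T_1 << ..., every distance is nearly T_i j, with i the last
   coordinate in which the two points differ.  Keeping only the first d - 1
   coordinates gives a set lying in a hyperplane. *)

(** * Inner product and Euclidean norm *)

Lemma dotvC d (u v : vec d) : dotv u v = dotv v u.
Proof. by apply: eq_bigr => i _; rewrite mulrC. Qed.

Lemma dotvDl d (u v w : vec d) : dotv (u + v) w = dotv u w + dotv v w.
Proof. by rewrite -big_split; apply: eq_bigr => i _; rewrite mxE mulrDl. Qed.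

Lemma dotvZl d c (u w : vec d) : dotv (c *: u) w = c * dotv u w.
Proof. by rewrite /dotv mulr_sumr; apply: eq_bigr => i _; rewrite mxE mulrA. Qed.

Lemma dotvNl d (u w : vec d) : dotv (- u) w = - dotv u w.
Proof. by rewrite -scaleN1r dotvZl mulN1r. Qed.

Lemma dotvDr d (u v w : vec d) : dotv w (u + v) = dotv w u + dotv w v.
Proof. by rewrite dotvC dotvDl !(dotvC w). Qed.

Lemma dotvZr d c (u w : vec d) : dotv w (c *: u) = c * dotv w u.
Proof. by rewrite dotvC dotvZl dotvC. Qed.

Lemma dotvNr d (u w : vec d) : dotv w (- u) = - dotv w u.
Proof. by rewrite dotvC dotvNl dotvC. Qed.

Definition dotvE := (dotvDl, dotvDr, dotvNl, dotvNr, dotvZl, dotvZr).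

Lemma dotv_ge0 d (u : vec d) : 0 <= dotv u u.
Proof. by apply: sumr_ge0 => i _; rewrite -expr2 sqr_ge0. Qed.

Lemma dotv_eq0 d (u : vec d) : (dotv u u == 0) = (u == 0).
Proof.
apply/idP/eqP => [|->]; last by rewrite /dotv big1 // => i _; rewrite mxE mul0r.
rewrite psumr_eq0 => [/allP h|i _]; last by rewrite -expr2 sqr_ge0.
apply/rowP => i; have := h i (mem_index_enum i).
by rewrite mxE mulf_eq0 orbb => /eqP.
Qed.

Lemma sqr_normv d (u : vec d) : normv u ^+ 2 = dotv u u.
Proof. by rewrite sqr_sqrtr ?dotv_ge0. Qed.

Lemma normv_ge0 d (u : vec d) : 0 <= normv u.
Proof. exact: sqrtr_ge0. Qed.

Lemma normv_gt0 d (u : vec d) : (0 < normv u) = (u != 0).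
Proof. by rewrite sqrtr_gt0 lt_def dotv_ge0 andbT dotv_eq0. Qed.

Lemma normvN d (u : vec d) : normv (- u) = normv u.
Proof. by rewrite /normv !dotvE opprK. Qed.

Lemma normvZ d c (u : vec d) : normv (c *: u) = `|c| * normv u.
Proof.
by rewrite /normv !dotvE mulrA -expr2 sqrtrM ?sqr_ge0 // sqrtr_sqr.
Qed.

Lemma le_normv d (u : vec d) c : 0 <= c -> (normv u <= c) = (dotv u u <= c ^+ 2).
Proof. by move=> c0; rewrite -sqr_normv ler_sqr // nnegrE normv_ge0. Qed.

Lemma cauchy_schwarz d (u v : vec d) : `|dotv u v| <= normv u * normv v.
Proof.
have [->|v0] := eqVneq v 0.
  rewrite -(scale0r 0) dotvZr mul0r normr0.
  by rewrite mulr_ge0 ?normv_ge0.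
have vv : 0 < dotv v v by rewrite lt_def dotv_ge0 dotv_eq0 v0.
rewrite -ler_sqr ?nnegrE ?mulr_ge0 ?normv_ge0 // exprMn !sqr_normv real_normK ?num_real //.
have := dotv_ge0 (dotv v v *: u - dotv u v *: v).
rewrite !dotvE (dotvC v u) => h.
rewrite -(ler_pM2l vv) -subr_ge0; apply: le_trans h _.
by rewrite le_eqVlt; apply/orP; left; apply/eqP; ring.
Qed.

Lemma ler_normvD d (u v : vec d) : normv (u + v) <= normv u + normv v.
Proof.
rewrite le_normv ?addr_ge0 ?normv_ge0 // !dotvE (dotvC v u) -!sqr_normv.
have := le_trans (ler_norm _) (cauchy_schwarz u v); lra.
Qed.

Lemma coord_le_normv d (u : vec d) i : `|u 0 i| <= normv u.
Proof.
rewrite -ler_sqr ?nnegrE ?normv_ge0 // sqr_normv real_normK ?num_real //.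
rewrite /dotv (bigD1 i) //= -expr2 lerDl.
by apply: sumr_ge0 => j _; rewrite -expr2 sqr_ge0.
Qed.

Lemma normv_le_coord d (u : vec d) h :
  0 <= h -> (forall i, `|u 0 i| <= h) -> normv u <= d%:R * h.
Proof.
move=> h0 uh; rewrite le_normv ?mulr_ge0 ?ler0n //.
have -> : (d%:R * h) ^+ 2 = (d * d)%:R * h ^+ 2 by rewrite exprMn -natrX mulnn.
apply: (@le_trans _ _ (\sum_(i < d) h ^+ 2)).
  apply: ler_sum => i _; rewrite -expr2 -(@real_normK _ (u 0 i)) ?num_real //.
  by rewrite ler_sqr // nnegrE.
rewrite sumr_const card_ord -[leLHS]mulr_natl ler_wpM2r ?sqr_ge0 // ler_nat.
by case: (d) => // n; rewrite leq_pmulr.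
Qed.

(** * Lowering the dimension of flatness inside a shell *)

(* Flatness at angle about alpha, stated through the distance to the direction
   space W and with rank at most m, which makes it stable under intersections. *)
Definition near_flat d M m (alpha : RR) (P : 'I_M -> vec d) (A : {set 'I_M}) :=
  forall a, a \in A -> exists W : 'M[RR]_d, (\rank W <= m)%N /\
    forall b, b \in A -> b != a -> exists w : vec d,
      (w <= W)%MS /\ normv (P a - P b - w) <= alpha * normv (P a - P b).

(* Both v and u are nearly in W and v is nearly orthogonal to u: replace W by
   its intersection with the orthogonal complement of the vector of W close to u. *)
Lemma cut_subspace d m (W : 'M[RR]_d) (u w' : vec d) (alpha beta : RR) :
  (\rank W <= m.+1)%N -> 0 <= alpha -> alpha <= 2^-1 -> u != 0 -> (w' <= W)%MS ->
  normv (u - w') <= alpha * normv u ->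
  exists W' : 'M[RR]_d, (\rank W' <= m)%N /\
    forall v w : vec d, (w <= W)%MS -> normv (v - w) <= alpha * normv v ->
      `|dotv v u| <= beta * normv v * normv u ->
      exists w2 : vec d, (w2 <= W')%MS /\
        normv (v - w2) <= (7 * alpha + 2 * beta) * normv v.
Proof.
move=> rW a0 a1 u0 w'W uw'.
have nu : 0 < normv u by rewrite normv_gt0.
have nw' : normv u <= 2 * normv w'.
  have := ler_normvD (u - w') w'; rewrite subrK => h.
  have := ler_wpM2r (ltW nu) a1; lra.
have nw'0 : 0 < normv w' by lra.
have dw' : dotv w' w' != 0 by rewrite dotv_eq0 -normv_gt0.
have dotvE' (x y : vec d) : (x *m y^T) 0 0 = dotv x y.
  by rewrite mxE; apply: eq_bigr => i _; rewrite mxE.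
exists (W :&: kermx w'^T)%MS; split.
  rewrite -ltnS (leq_trans _ rW) // ltn_neqAle mxrankS ?capmxSl // andbT.
  (* Equal ranks would put [w'] in its own orthogonal complement. *)
  apply: contraNneq dw' => e.
  have : (W <= W :&: kermx w'^T)%MS by rewrite -(geq_leqif (mxrank_leqif_sup (capmxSl _ _))) e.
  move=> /(submx_trans w'W); rewrite sub_capmx => /andP[_ /sub_kermxP k0].
  by rewrite -dotvE' k0 mxE.
move=> v w wW vw vu.
have nv := normv_ge0 v.
pose c := dotv w w' / dotv w' w'.
exists (w - c *: w'); split.
  rewrite sub_capmx addmx_sub ?eqmx_opp ?scalemx_sub //=.
  apply/sub_kermxP/matrixP => i j; rewrite !ord1 dotvE' !dotvE mxE.
  by rewrite /c divfK // subrr.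
have nc : normv (c *: w') = `|dotv w w'| / normv w'.
  rewrite normvZ /c normrM normfV -sqr_normv [`|normv w' ^+ 2|]ger0_norm ?sqr_ge0 //.
  by field; rewrite gt_eqF.
(* The three terms are at most [beta], [alpha] and [2 * alpha] times [normv v * normv u]. Removing
   the [w'] component of [w] thus costs [2 * (3 * alpha + beta)], on top of the [alpha] between [v]
   and [w]. *)
have ew : dotv w w' = dotv v u - dotv (v - w) u - dotv w (u - w').
  by rewrite !dotvE; ring.
have nw : normv w <= (1 + alpha) * normv v.
  have := ler_normvD v (- (v - w)); rewrite normvN opprB addrCA subrr addr0 => h; lra.
have nww' : `|dotv w w'| <= (3 * alpha + beta) * normv v * (2 * normv w').
  rewrite {1}ew; apply: le_trans (ler_normB _ _) _.
  have h1 := ler_normB (dotv v u) (dotv (v - w) u).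
  have h2 := le_trans (cauchy_schwarz _ _) (ler_wpM2r (ltW nu) vw).
  have h3 : `|dotv w (u - w')| <= (1 + alpha) * normv v * (alpha * normv u).
    by apply: le_trans (cauchy_schwarz _ _) _; apply: ler_pM; rewrite ?normv_ge0.
  have h4 : (1 + alpha) * normv v * (alpha * normv u) <= 2 * alpha * normv v * normv u.
    have : 0 <= alpha * normv v * normv u by rewrite !mulr_ge0 // ltW.
    nra.
  have h5 : 0 <= beta * normv v * normv u by apply: le_trans vu.
  have h6 : 0 <= (3 * alpha + beta) * normv v.
    rewrite -(pmulr_lge0 _ nu).
    have : 0 <= alpha * normv v * normv u by rewrite !mulr_ge0 // ltW.
    lra.
  have := ler_wpM2l h6 nw'; lra.
have : normv (c *: w') <= 2 * (3 * alpha + beta) * normv v.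
  rewrite nc ler_pdivrMr //; lra.
rewrite opprB addrA addrAC.
have := ler_normvD (v - w) (c *: w'); lra.
Qed.

Lemma near_flat_le d M m (alpha beta : RR) (P : 'I_M -> vec d) A :
  alpha <= beta -> near_flat m alpha P A -> near_flat m beta P A.
Proof.
move=> ab fA a aA; have [W [rW hW]] := fA a aA.
exists W; split=> // b bA ba; have [w [wW le_w]] := hW b bA ba.
exists w; split=> //; apply: le_trans le_w _.
by rewrite ler_wpM2r ?normv_ge0.
Qed.

Lemma eps_nearly_kdist_le d k M (e e' : RR) (P : 'I_M -> vec d) :
  e <= e' -> eps_nearly_kdist k e P -> eps_nearly_kdist k e' P.
Proof.
move=> ee [sP [t [t1 [ti tP]]]]; split=> //; exists t; do 2!split=> //.
move=> a b ab; have [i /andP[h1 h2]] := tP a b ab.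
by exists i; rewrite h1 (le_trans h2) // lerD2l.
Qed.

(** By the law of cosines with [u = P a - P p] and [v = P a - P b], twice [dotv v u] is
    [normv v ^+ 2] plus a difference of two squares in the shell, of order [alpha * t]. Since
    [1 <= normv v <= alpha * t], both are small against [normv v * normv u], so [cut_subspace]
    applies with [beta = 2 * alpha], and 7 + 2 * 2 = 11. *)
Lemma shell_piece_flat d M m (alpha t : RR) (P : 'I_M -> vec d) (A B : {set 'I_M}) p :
  Defs.separated P -> 0 <= alpha -> alpha <= 2^-1 -> 1 <= t ->
  near_flat m.+1 alpha P A -> p \in A -> p \notin B -> B \subset A ->
  (forall b, b \in B -> t <= normv (P b - P p) <= t + alpha) ->
  (forall b b', b \in B -> b' \in B -> normv (P b - P b') <= alpha * t) ->
  near_flat m (11 * alpha) P B.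
Proof.
move=> sP a0 a1 t1 fA pA pB /fintype.subsetP BA shell diam a aB.
have ap : p != a by apply: contraNneq pB => ->.
have [W [rW hW]] := fA a (BA a aB).
have [w' [w'W le_w']] := hW p pA ap.
have u0 : P a - P p != 0.
  rewrite -normv_gt0; have /andP[h _] := shell a aB.
  by apply: lt_le_trans h; apply: lt_le_trans t1.
have [W' [rW' hW']] := cut_subspace (2 * alpha) rW a0 a1 u0 w'W le_w'.
exists W'; split=> // b bB ba.
have [w [wW le_w]] := hW b (BA b bB) ba.
have -> : 11 * alpha = 7 * alpha + 2 * (2 * alpha) by ring.
apply: hW' wW le_w _.
have /andP[h1 h2] := shell a aB; have /andP[h3 h4] := shell b bB.
have v1 : 1 <= normv (P a - P b) by apply: sP; rewrite eq_sym.
have vt := diam a b aB bB.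
set u := P a - P p in h1 h2 *; set v := P a - P b in v1 vt *.
have e : normv (P b - P p) ^+ 2 = normv u ^+ 2 - 2 * dotv v u + normv v ^+ 2.
  have -> : P b - P p = u - v by rewrite /u /v opprB [RHS]addrC subrKA.
  by clearbody u v; rewrite !sqr_normv !dotvE (dotvC u v); ring.
move: e h1 h2 h3 h4 v1 vt.
move: (normv u) (normv v) (normv (P b - P p)) (dotv v u) => nu nv n s e h1 h2 h3 h4 v1 vt.
have t0 : 0 <= t by lra.
have sq x : t <= x -> x <= t + alpha -> t ^+ 2 <= x ^+ 2 <= t ^+ 2 + 3 * alpha * t.
  move=> x1 x2; apply/andP; split; first by rewrite ler_sqr // nnegrE //; lra.
  have -> : t ^+ 2 + 3 * alpha * t = (t + alpha) ^+ 2 + alpha * (t - alpha) by ring.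
  apply: ler_wpDr; first by rewrite mulr_ge0 //; lra.
  by rewrite ler_sqr // nnegrE; lra.
have /andP[q1 q2] := sq _ h1 h2; have /andP[q3 q4] := sq _ h3 h4.
have v2 : nv ^+ 2 <= alpha * t * nv by rewrite expr2 ler_wpM2r //; lra.
have at0 : 0 <= alpha * t by rewrite mulr_ge0.
have v3 : alpha * t <= alpha * t * nv by rewrite ler_peMr.
have v4 : alpha * t * nv <= alpha * nv * nu.
  by rewrite mulrAC ler_wpM2l // mulr_ge0 //; lra.
have v5 := sqr_ge0 nv.
rewrite ler_norml; apply/andP; split; lra.
Qed.

(** * Cells and the counting induction *)

(** Cubes of side proportional to [t] cover the ball of radius [2 * t], so [K] does not depend on
    [t]. Writing [d.+1] for [d] in the side keeps the division safe in dimension 0. *)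
Lemma grid_cells d (gamma : RR) : 0 < gamma ->
  exists K : nat, forall t : RR, 0 < t -> exists c : vec d -> 'I_K,
    forall u v, normv u <= 2 * t -> normv v <= 2 * t -> c u = c v ->
    normv (u - v) <= gamma * t.
Proof.
move=> g0; pose N := (Num.truncn (4 * d.+1%:R / gamma : RR)).+1.
exists #|{ffun 'I_d -> 'I_N}| => t t0.
pose h : RR := gamma * t / d.+1%:R.
have h0 : 0 < h by rewrite divr_gt0 ?mulr_gt0 ?ltr0Sn.
pose c0 (u : vec d) (i : 'I_d) : 'I_N := inord (Num.truncn ((u 0 i + 2 * t) / h)).
exists (fun u => enum_rank [ffun i => c0 u i]) => u v ut vt /enum_rank_inj /ffunP cuv.
have ch (w : vec d) i : normv w <= 2 * t ->
    (c0 w i)%:R * h <= w 0 i + 2 * t < (c0 w i).+1%:R * h.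
  move=> wt; have := le_trans (coord_le_normv w i) wt.
  rewrite ler_norml => /andP[w1 w2].
  have q0 : 0 <= (w 0 i + 2 * t) / h by rewrite divr_ge0 ?(ltW h0) //; lra.
  rewrite /c0 inordK.
    have /andP[r1 r2] := truncn_itv q0.
    by rewrite -ler_pdivlMr // -ltr_pdivrMr // r1 r2.
  rewrite ltnS le_truncn // ler_pdivrMr //.
  have -> : 4 * d.+1%:R / gamma * h = 4 * t.
    have := ltr0Sn RR d; rewrite /h; move: (d.+1%:R : RR) => D D0.
    by field; rewrite !gt_eqF.
  lra.
have dist i : `|(u - v) 0 i| <= h.
  have := ch _ i ut; have := ch _ i vt; have := cuv i; rewrite !ffunE => ->.
  rewrite !mxE -natr1 ler_norml => /andP[a1 a2] /andP[b1 b2]; lra.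
apply: le_trans (normv_le_coord (ltW h0) dist) _.
rewrite /h mulrC -[leLHS]mulrA ler_piMr ?mulr_ge0 ?ltW //.
by rewrite mulrC ltr_pdivrMr ?ltr0Sn // mul1r ltr_nat.
Qed.

Lemma card_le_fibers (T S : finType) (A : {set T}) (f : T -> S) n :
  (forall s, (#|[set x in A | f x == s]| <= n)%N) -> (#|A| <= #|S| * n)%N.
Proof.
move=> hf; rewrite -sum1_card (partition_big f predT) //=.
rewrite -sum_nat_const; apply: leq_sum => s _.
by apply: leq_trans (hf s); rewrite -sum1_card; under [leqRHS]eq_bigl do rewrite inE.
Qed.

Lemma near_flat_card d m : exists (alpha : RR) (C : nat), 0 < alpha /\
  forall k M (P : 'I_M -> vec d) (A : {set 'I_M}), (0 < k)%N ->
    eps_nearly_kdist k alpha P -> near_flat m alpha P A -> (#|A| <= C * k ^ m)%N.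
Proof.
elim: m => [|m [a0 [C [a0gt0 IH]]]].
  exists 2^-1, 1%N; split=> [|k M P A _ [sP _] fA]; first by rewrite invr_gt0.
  rewrite expn0 muln1; apply/card_le1_eqP => a b aA bA; apply/eqP.
  apply: contraT => ab; have [W [rW hW]] := fA a aA.
  have [w [wW]] := hW b bA ab.
  (* Rank 0 forces [w = 0], so a distance of at least 1 would be at most half of itself. *)
  move: wW; move: rW; rewrite leqn0 mxrank_eq0 => /eqP -> /submx0null ->.
  by rewrite subr0; have := sP a b; rewrite eq_sym ab => /(_ isT); lra.
(* The factor 11 pays for the loss in [shell_piece_flat]; the bound 1/2 is what that lemma
   assumes. *)
pose a1 := Num.min (a0 / 11) 2^-1.
have a1gt0 : 0 < a1 by rewrite lt_min divr_gt0 //= invr_gt0.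
have a1le : a1 <= 2^-1 by rewrite ge_min lexx orbT.
have a1le0 : 11 * a1 <= a0 by rewrite mulrC -ler_pdivlMr // ge_min lexx.
have [K cells] := grid_cells d a1gt0.
exists a1, (1 + K * C)%N; split=> // k M P A k0 nP fA.
have [sP [t [t1 [_ tP]]]] := nP.
have [->|[p pA]] := set_0Vmem A; first by rewrite cards0.
have /boolp.choice[g gP] b : exists i : 'I_k, b != p ->
    t i <= normv (P b - P p) <= t i + a1.
  have [->|/tP [i hi]] := eqVneq b p; last by exists i.
  (* An arbitrary shell for [p] itself, which is removed before counting. *)
  by exists (Ordinal k0).
have /boolp.choice[c cP] i : exists c : vec d -> 'I_K, forall u v,
    normv u <= 2 * t i -> normv v <= 2 * t i -> c u = c v ->
    normv (u - v) <= a1 * t i.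
  by apply: cells; apply: lt_le_trans (t1 i).
have : (#|A :\ p| <= #|{: 'I_k * 'I_K}| * (C * k ^ m))%N.
  apply: (@card_le_fibers _ _ _ (fun b => (g b, c (g b) (P b - P p)))) => -[i j].
  apply: IH k0 (eps_nearly_kdist_le _ nP) _; first by lra.
  apply: near_flat_le a1le0 _.
  have inB b : b \in [set x in A :\ p | (g x, c (g x) (P x - P p)) == (i, j)] ->
      [/\ b != p, b \in A, g b = i & c i (P b - P p) = j].
    by rewrite !inE => /andP[/andP[? ?]] /eqP[<- <-].
  have norm2 b : b != p -> g b = i -> normv (P b - P p) <= 2 * t i.
    by move=> /gP/andP[_] /[swap] ->; have := t1 i; lra.
  apply: (@shell_piece_flat _ _ _ _ (t i) _ A _ p) => //; first exact: ltW.
  - by rewrite !inE eqxx.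
  - by apply/fintype.subsetP => b /inB[].
  - by move=> b /inB[bp _ <- _]; exact: gP.
  move=> b b' /inB[bp _ gb cb] /inB[bp' _ gb' cb'].
  have := cP i (P b - P p) (P b' - P p); rewrite cb cb' opprB addrA subrK.
  by apply=> //; exact: norm2.
rewrite card_prod !card_ord (cardsD1 p A) pA expnS => h.
(* The summand 1 of the constant accounts for [p]. *)
rewrite mulnDl mul1n leq_add //; first by rewrite muln_gt0 k0 expn_gt0 k0.
by apply: leq_trans h _; rewrite (mulnC k) mulnACA.
Qed.

(** * From angles to distances and back *)

Lemma vangle_cos_itv d (u v : vec d) :
  -1 <= dotv u v / (normv u * normv v) <= 1.
Proof.
rewrite -ler_norml normrM normfV.
have : 0 <= normv u * normv v by rewrite mulr_ge0 ?normv_ge0.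
rewrite le_eqVlt => /orP[/eqP <-|uv]; first by rewrite normr0 invr0 mulr0 ler01.
by rewrite (gtr0_norm uv) ler_pdivrMr // mul1r cauchy_schwarz.
Qed.

Lemma vangle_ge0 d (u v : vec d) : 0 <= vangle u v.
Proof. exact/acos_ge0/vangle_cos_itv. Qed.

(** The distance from [v] to the line of [w] is [normv v] times the sine of the angle. With [c] the
    cosine, [1 - c ^+ 2 <= 2 * (1 - c)], so continuity of cosine at 0 with tolerance
    [delta ^+ 2 / 2] suffices. *)
Lemma vangle_near_line (delta : RR) : 0 < delta ->
  exists2 alpha : RR, 0 < alpha &
    forall d (v w : vec d), w != 0 -> vangle v w < alpha ->
    exists c, normv (v - c *: w) <= delta * normv v.
Proof.
move=> d0.
have /cvgrPdist_lt /(_ (delta ^+ 2 / 2)) := @continuous_cos RR 0.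
rewrite divr_gt0 ?exprn_gt0 // => /(_ isT) /nbhs_ballP[alpha /= a0 ha].
exists alpha => // d v w w0 vw; exists (dotv v w / dotv w w).
have nw : 0 < normv w by rewrite normv_gt0.
have [->|v0] := eqVneq v 0.
  by rewrite -(scale0r 0) dotvZl !mul0r !scale0r subr0 -(scale0r 0) normvZ normr0 mul0r mulr0.
have nv : 0 < normv v by rewrite normv_gt0.
have := ha (vangle v w).
rewrite /ball /= sub0r normrN ger0_norm ?vangle_ge0 // cos0 => /(_ vw).
have citv := vangle_cos_itv v w.
rewrite /vangle acosK ?in_itv //=; set c := _ / _ in citv * => hc.
rewrite le_normv ?mulr_ge0 ?normv_ge0 ?(ltW d0) // exprMn sqr_normv.
have -> : dotv (v - (dotv v w / dotv w w) *: w) (v - (dotv v w / dotv w w) *: w) =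
    normv v ^+ 2 * (1 - c ^+ 2).
  rewrite !dotvE (dotvC w v) -!sqr_normv /c; field.
  by rewrite !gt_eqF.
rewrite sqr_normv [leLHS]mulrC ler_wpM2r ?dotv_ge0 //.
have := ler_norm (1 - c); case/andP: citv => c1 c2 h; nra.
Qed.

(** Halving [e] makes the infimum strictly below [e], so some actual direction has angle below
    [e]. *)
Lemma flat_near_flat (delta : RR) : 0 < delta ->
  exists2 alpha : RR, 0 < alpha &
    forall d m M (P : 'I_M -> vec d), (0 < m)%N -> Defs.separated P ->
    flat m alpha P -> near_flat m delta P [set: 'I_M]%SET.
Proof.
move=> /vangle_near_line [e e0 he]; exists (e / 2); first by rewrite divr_gt0.
move=> d m M P m0 sP fP a _; have [L [[x0 [W [rW ->]]] hL]] := fP a.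
exists W; split=> [|b _ ba]; first by rewrite rW.
have ab : P b != P a.
  rewrite eq_sym -subr_eq0 -normv_gt0; apply: lt_le_trans ltr01 _.
  by apply: sP; rewrite eq_sym.
have : plane_angle (P a - P b) [set x0 + w | w in [set w : vec d | (w <= W)%MS]]%classic < e.
  by apply: le_lt_trans (hL _ _) _; [exists b|lra].
case/inf_lt.
  (* As [m] is positive, a nonzero row of [W] shows that the infimum is over a nonempty set. *)
  have /matrix0Pn[i [j Wij]] : W != 0 by rewrite -mxrank_eq0 rW -lt0n.
  exists (vangle (P a - P b) (row i W)), (row i W) => //; split.
    exists (x0 + row i W), (x0 + 0); split; first by exists (row i W); rewrite //= row_sub.
    split; first by exists 0 => //=; rewrite sub0mx.
    by rewrite addr0 addrAC subrr add0r.
  by apply: contraNneq Wij => /rowP/(_ j); rewrite !mxE => ->.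
move=> _ [w [[_ [_ [[w1 /= W1 <-] [[w2 /= W2 <-] ew]]]] w0] <-].
move=> /(he _ _ _ w0) [c hc]; exists (c *: w); split=> //.
apply: scalemx_sub.
by rewrite ew opprD addrACA subrr add0r addmx_sub ?eqmx_opp.
Qed.

(** The row space of [pid_mx m] is the span of the first [m] axes; each difference lies in it and
    makes angle 0 with itself. *)
Lemma coord_flat d m M (alpha : RR) (P : 'I_M -> vec d) : (m <= d)%N -> 0 <= alpha ->
  (forall a (i : 'I_d), (m <= i)%N -> P a 0 i = 0) -> flat m alpha P.
Proof.
move=> md a0 P0 a.
exists [set 0 + w | w in [set w : vec d | (w <= (pid_mx m : 'M[RR]_d))%MS]]%classic; split.
  by exists 0, (pid_mx m); rewrite rank_pid_mx.
have inL b : (P b <= (pid_mx m : 'M[RR]_d))%MS.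
  suff -> : P b = P b *m pid_mx m by exact: submxMl.
  apply/rowP => i; rewrite mxE (bigD1 i) //= big1 => [|j ji].
    rewrite mxE eqxx /= addr0; case: ltnP => [_|mi]; first by rewrite mulr1.
    by rewrite P0 // mul0r.
  by rewrite mxE (inj_eq val_inj) (negbTE ji) mulr0.
move=> _ [b /= ab <-]; apply: le_trans a0.
have v0 : P a - P b != 0 by rewrite subr_eq0 eq_sym.
have -> : 0 = vangle (P a - P b) (P a - P b).
  rewrite /vangle -expr2 sqr_normv divff ?dotv_eq0 ?acos1 //.
apply: ge_inf; first by exists 0 => _ [w _ <-]; exact: vangle_ge0.
exists (P a - P b) => //; split=> //; exists (P a), (P b).
by do !split=> //; [exists (P a)|exists (P b)]; rewrite ?add0r //=.
Qed.

(** * The tower grid for the lower bounds *)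

(** Growth is quadratic because a lower coordinate of size [T_i] lengthens a vector of size [T_l] by
    about [T_i ^+ 2 / T_l], which must be small. *)
Fixpoint tower (K : RR) n : RR := if n is n'.+1 then K * tower K n' ^+ 2 else 1.

Lemma tower_ge1 K n : 1 <= K -> 1 <= tower K n.
Proof. by move=> K1; elim: n => //= n IH; nra. Qed.

Lemma tower_le K : 1 <= K -> {homo tower K : i j / (i <= j)%N >-> i <= j}.
Proof.
move=> K1; apply: homo_leq => [//||n]; first exact: le_trans.
by have := tower_ge1 n K1 => /=; nra.
Qed.

Lemma tower_sqr_le K i j : 1 <= K -> (i < j)%N -> K * tower K i ^+ 2 <= tower K j.
Proof. by move=> K1 /(tower_le K1). Qed.

(** For positive [m], index [q * m + (j - 1)] encodes the distance [T_q * j] with [1 <= j <= m]; for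
    [m = 0] the division conventions give [n + 1], still increasing. *)
Definition tower_scale m K n := tower K (n %/ m) * (n %% m).+1%:R.

Lemma tower_scale_ge1 m K n : 1 <= K -> 1 <= tower_scale m K n.
Proof. by move=> K1; rewrite mulr_ege1 ?tower_ge1 ?ler1n. Qed.

Lemma tower_scale_lt m (K : RR) i j : m.+1%:R <= K -> (i < j)%N ->
  tower_scale m K i < tower_scale m K j.
Proof.
move=> mK ij; have K1 : 1 <= K by apply: le_trans mK; rewrite ler1n.
have Tgt0 n : 0 < tower K n by apply: lt_le_trans (tower_ge1 n K1).
rewrite /tower_scale; have [->|m0] := posnP m.
  by rewrite !divn0 !modn0 ltr_pM2l // ltr_nat.
have := leq_div2r m (ltnW ij); rewrite leq_eqVlt => /orP[/eqP e|q].
  rewrite e ltr_pM2l // ltr_nat ltnS.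
  by move: ij; rewrite {1}(divn_eq i m) {1}(divn_eq j m) e ltn_add2l.
have h1 := tower_sqr_le K1 q; have T1 := tower_ge1 (i %/ m) K1.
have h2 : (i %% m).+1%:R <= m%:R :> RR by rewrite ler_nat ltn_mod.
have h3 : 1 <= (j %% m).+1%:R :> RR by rewrite ler1n.
have h4 := Tgt0 (j %/ m)%N; move: mK; rewrite -natr1 => mK.
apply: (@lt_le_trans _ _ (tower K (j %/ m))); last by rewrite ler_peMr // ltW.
apply: lt_le_trans h1; apply: (@le_lt_trans _ _ (tower K (i %/ m) * m%:R)).
  by rewrite ler_pM2l.
apply: (@lt_le_trans _ _ (tower K (i %/ m) * K)); first by rewrite ltr_pM2l //; lra.
by rewrite mulrC expr2 mulrA ler_peMr // mulr_ge0 ?(ltW (Tgt0 _)) // (le_trans ler01).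
Qed.

Lemma tower_dist d m (K eps : RR) (z : 'I_d -> RR) (l : 'I_d) :
  1 <= K -> 0 < eps -> d%:R * m%:R ^+ 2 <= K * eps -> 1 <= `|z l| ->
  (forall i : 'I_d, (l < i)%N -> z i = 0) -> (forall i, `|z i| <= m%:R) ->
  tower K l * `|z l| <= normv (\row_i (tower K i * z i)) <= tower K l * `|z l| + eps.
Proof.
move=> K1 e0 hK zl zgt zm; have T1 i := tower_ge1 i K1.
have Tl0 : 0 <= tower K l * `|z l| by rewrite mulr_ge0 // (le_trans ler01).
have d0 : 0 < d%:R :> RR by rewrite ltr0n (leq_trans _ (ltn_ord l)).
set u := \row_i _.
have ul : u 0 l = tower K l * z l by rewrite mxE.
apply/andP; split.
  have := coord_le_normv u l.
  by rewrite ul normrM ger0_norm // (le_trans ler01).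
rewrite le_normv ?addr_ge0 ?(ltW e0) // /dotv (bigD1 l) //= ul -expr2.
have -> : (tower K l * z l) ^+ 2 = (tower K l * `|z l|) ^+ 2.
  by rewrite !exprMn real_normK // num_real.
(* Each lower square is at most [eps * tower K l / d]. As [1 <= |z l|], the sum is below the cross
   term in the square of [tower K l * |z l| + eps]. *)
have : \sum_(i < d | i != l) u 0 i * u 0 i <= eps * tower K l.
  apply: (@le_trans _ _ (\sum_(i < d) eps * tower K l / d%:R)); last first.
    by rewrite sumr_const card_ord -[leLHS]mulr_natr divfK ?gt_eqF.
  have B0 : 0 <= eps * tower K l / d%:R.
    by rewrite divr_ge0 ?ler0n // mulr_ge0 ?(ltW e0) // (le_trans ler01).
  rewrite [leRHS](bigID (fun i => i != l)) /= ler_wpDr ?sumr_ge0 // ler_sum // => i il.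
  rewrite mxE -expr2; have [li|] := ltnP l i.
    by rewrite zgt // mulr0 expr0n.
  rewrite leq_eqVlt (inj_eq val_inj) (negbTE il) /= => /(tower_sqr_le K1) h.
  rewrite ler_pdivlMr // exprMn -(@real_normK _ (z i)) ?num_real //.
  have zz : `|z i| ^+ 2 <= m%:R ^+ 2 by rewrite ler_sqr ?nnegrE ?ler0n.
  have tt := sqr_ge0 (tower K i).
  have h2 : eps * (K * tower K i ^+ 2) <= eps * tower K l by rewrite ler_pM2l.
  apply: le_trans h2.
  have h3 := ler_wpM2l tt (le_trans (ler_wpM2l (ltW d0) zz) hK); lra.
move=> hs.
have h4 : tower K l <= tower K l * `|z l| by rewrite ler_peMr // (le_trans ler01).
have h5 := ler_wpM2l (ltW e0) h4; have := sqr_ge0 eps.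
have h6 : 0 <= eps * tower K l by rewrite mulr_ge0 ?(ltW e0) // (le_trans ler01).
rewrite sqrrD; lra.
Qed.

(** If [l + 1] is the least exponent at which the quotients by powers of [B] agree, all digits above
    [l] agree, and equal digits at [l] would contradict minimality. *)
Lemma top_digit B n a b : (a < B ^ n)%N -> (b < B ^ n)%N -> a != b ->
  exists2 l, (l < n)%N & ((a %/ B ^ l) %% B != (b %/ B ^ l) %% B)%N /\
    forall i, (l < i)%N -> ((a %/ B ^ i) %% B = (b %/ B ^ i) %% B)%N.
Proof.
move=> an bn ab.
have ex : exists l, (a %/ B ^ l == b %/ B ^ l)%N by exists n; rewrite !divn_small.
case: (ex_minnP ex) => -[|l] /eqP hl lmin; first by rewrite !divn1 in hl; rewrite hl eqxx in ab.
have ln : (l < n)%N by apply: lmin; rewrite !divn_small.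
exists l => //; split=> [|i li].
  apply/eqP => e; suff : (l < l)%N by rewrite ltnn.
  apply: lmin; apply/eqP.
  rewrite (divn_eq (a %/ B ^ l) B) (divn_eq (b %/ B ^ l) B) e.
  by rewrite -!divnMA -expnSr hl.
by rewrite -(subnKC li) expnD !divnMA hl.
Qed.

(* Points whose i-th coordinate is T_i times a base-(k/d + 1) digit; T grows so
   fast that a distance is governed by the top differing digit alone. *)
Lemma tower_grid d n k (eps : RR) : (0 < d)%N -> (n <= d)%N -> 0 < eps ->
  exists P : 'I_((k %/ d).+1 ^ n) -> vec d,
    eps_nearly_kdist k eps P /\ forall a (i : 'I_d), (n <= i)%N -> P a 0 i = 0.
Proof.
move=> d0 nd e0; set m := (k %/ d)%N.
(* The first summand makes the scales increase; the second bounds the error in [tower_dist]. *)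
pose K : RR := m.+1%:R + d%:R * m%:R ^+ 2 / eps.
have q0 : 0 <= d%:R * m%:R ^+ 2 / eps by rewrite divr_ge0 ?mulr_ge0 ?ler0n ?(ltW e0) ?exprn_ge0.
have mK : m.+1%:R <= K by rewrite lerDl.
have K1 : 1 <= K by apply: le_trans mK; rewrite ler1n.
have hK : d%:R * m%:R ^+ 2 <= K * eps by rewrite -ler_pdivrMr // lerDr ler0n.
pose dig (a i : nat) := ((a %/ m.+1 ^ i) %% m.+1)%N.
pose P (a : 'I_(m.+1 ^ n)) : vec d := \row_i (tower K i * (dig a i)%:R).
have dist a b : a != b -> exists i : 'I_k,
    tower_scale m K i <= normv (P a - P b) <= tower_scale m K i + eps.
  move=> ab; have [l ln [dl dgt]] := top_digit (ltn_ord a) (ltn_ord b) ab.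
  have ld := leq_trans ln nd.
  pose z (i : 'I_d) : RR := (dig a i)%:R - (dig b i)%:R.
  have -> : P a - P b = \row_i (tower K i * z i).
    by apply/rowP => i; rewrite !mxE -mulrBr.
  have digm x i : (dig x i <= m)%N by rewrite -ltnS ltn_mod.
  pose j := `|(dig a l)%:Z - (dig b l)%:Z|%N.
  have j0 : (0 < j)%N by move: dl; rewrite /j -/(dig a l) -/(dig b l); lia.
  have jm : (j <= m)%N by have := digm a l; have := digm b l; rewrite /j; lia.
  have zE i : `|z i| = `|(dig a i)%:Z - (dig b i)%:Z|%N%:R.
    by rewrite natr_absz intr_norm rmorphB /=.
  have zm i : `|z i| <= m%:R.
    by rewrite zE ler_nat; have := digm a i; have := digm b i; lia.
  (* Only the first [d * m <= k] scales occur as distances. *)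
  have lt_k : (l * m + j.-1 < k)%N.
    apply: leq_trans (leq_trunc_div k d); rewrite -/m mulnC.
    apply: (@leq_trans (l.+1 * m)%N); last by rewrite mulnC leq_mul2l ld orbT.
    by rewrite mulSn; lia.
  exists (Ordinal lt_k).
  have jlt : (j.-1 < m)%N by lia.
  rewrite /tower_scale /= divnMDl ?(leq_trans j0) // divn_small // addn0.
  rewrite modnMDl modn_small // prednK //.
  have := @tower_dist d m K eps z (Ordinal ld) K1 e0 hK.
  rewrite zE -/j /=; apply=> //; first by rewrite ler1n.
  by move=> i /dgt e; rewrite /z /dig e subrr.
exists P; split=> [|a i ni]; last first.
  rewrite mxE /dig divn_small ?mod0n ?mulr0 //.
  by apply: leq_trans (ltn_ord a) _; rewrite leq_pexp2l.
split.
  move=> a b /dist[i /andP[h _]]; apply: le_trans h; exact: tower_scale_ge1.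
exists (fun i => tower_scale m K i); split; [|split]=> //.
- by move=> i; apply: tower_scale_ge1.
- by move=> i j; apply: tower_scale_lt.
Qed.

(** * Assembling the bounds *)

Lemma pow_div_le d n k : (0 < d)%N ->
  (k%:R / d%:R) ^+ n <= ((k %/ d).+1 ^ n)%:R :> RR.
Proof.
move=> d0; rewrite natrX lerXn2r ?nnegrE ?divr_ge0 ?ler0n //.
by rewrite ler_pdivrMr ?ltr0n // -natrM ler_nat ltnW // ltn_ceil.
Qed.

(* "c k^d <= M_k(d) <= C k^d" with M_k(d) the LARGEST admissible M is stated as:
   some admissible M is >= c k^d, and every admissible M is <= C k^d. *)
Theorem theorem8 (d : nat) (hd : (2 <= d)%N) :
  exists c C : RR, 0 < c /\ c <= C /\
    forall k : nat, (1 <= k)%N ->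
      ((exists M : nat, M_admissible d k M /\ c * k%:R ^+ d <= M%:R) /\
       (forall M : nat, M_admissible d k M -> M%:R <= C * k%:R ^+ d)) /\
      ((exists N : nat, N_admissible d k N /\ c * k%:R ^+ d.-1 <= N%:R) /\
       (forall N : nat, N_admissible d k N -> N%:R <= C * k%:R ^+ d.-1)).
Proof.
have d0 : (0 < d)%N by exact: ltnW.
have [e1 [C1 [e1_gt0 ub1]]] := near_flat_card d d.
have [e2 [C2 [e2_gt0 ub2]]] := near_flat_card d d.-1.
have [al al_gt0 hal] := flat_near_flat e2_gt0.
have cle1 : d%:R^-1 <= 1 :> RR by rewrite invf_le1 ?ltr0n ?ler1n.
have c0 : 0 <= d%:R^-1 :> RR by rewrite invr_ge0 ler0n.
(* The lower constant also serves exponent [d.-1], since [d%:R^-1 <= 1]; the summand 1 ensures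
   [c <= C]. *)
exists (d%:R^-1 ^+ d), (1 + C1 + C2)%:R; split; first by rewrite exprn_gt0 ?invr_gt0 ?ltr0n.
split; first by apply: (@le_trans _ _ 1); rewrite ?exprn_ile1 // ler1n -addnA.
move=> k k1; split; split.
- exists ((k %/ d).+1 ^ d)%N; split=> [eps eps0|].
    by have [P [hP _]] := tower_grid k d0 (leqnn d) eps0; exists P.
  by apply: le_trans (pow_div_le d k d0); rewrite exprMn mulrC.
- move=> M /(_ _ e1_gt0)[P hP].
  have := ub1 _ _ _ [set: 'I_M]%SET k1 hP; rewrite cardsT card_ord => h.
  rewrite -natrX -natrM ler_nat (leq_trans (h _)) //.
    (* With the whole space as direction space, flatness is automatic. *)
    move=> a _; exists 1%:M; split=> [|b _ _]; first by rewrite mxrank1.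
    exists (P a - P b); rewrite submx1 subrr -(scale0r 0) normvZ normr0 mul0r.
    by split=> //; rewrite mulr_ge0 ?normv_ge0 // ltW.
  by rewrite leq_mul2r; apply/orP; right; lia.
- exists ((k %/ d).+1 ^ d.-1)%N; split=> [eps alpha eps0 alpha0|].
    have [P [hP P0]] := tower_grid k d0 (leq_pred d) eps0; exists P; split=> //.
    by apply: coord_flat => //; [exact: leq_pred|exact: ltW].
  apply: le_trans (pow_div_le d.-1 k d0); rewrite exprMn mulrC ler_wpM2l ?exprn_ge0 //.
  by rewrite ler_wiXn2l ?leq_pred.
- move=> N /(_ _ _ e2_gt0 al_gt0)[P [hP fP]].
  have d1 : (0 < d.-1)%N by lia.
  have := ub2 _ _ _ _ k1 hP (hal _ _ _ _ d1 (proj1 hP) fP).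
  rewrite cardsT card_ord => h; rewrite -natrX -natrM ler_nat (leq_trans h) //.
  by rewrite leq_mul2r; apply/orP; right; lia.
Qed.
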